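(* Let $b>0$, $N\ge1$, $R>0$ and vectors $\Phi_0,\Psi_0,\Psi_b\in\mathbb{R}^N$ be given, and let $$G_1=G_1(R,\Phi_0,\Psi_0,\Psi_b)=\big\{Q=(q_0,\dots,q_{N-1})^T\in H^2(0,b):\ \|Q\|_{H^2(0,b)}<R,\ Q(0)=\Phi_0,\ Q'(0)=\Psi_0,\ Q'(b)=\Psi_b\big\}.$$ For $\lambda>1$ let $\varphi_\lambda(x)=e^{-\lambda x}$ and $$\overline{J}_\lambda(Q)=\int_0^b\big|Q''+F(Q')\big|^2\varphi_\lambda^2(x)\,dx .$$ Then there exists a sufficiently large number $\lambda_2=\lambda_2(G_1,F)>1$, depending only on $G_1$ and $F$, such that for all $\lambda\ge\lambda_2$ the functional $\overline{J}_\lambda$ is strictly convex on $G_1$, i.e., there exists a constant $C_3=C_3(G_1,F)>0$ depending only on $G_1$ and $F$ such that for all $Q_1,Q_2\in G_1$ $$\overline{J}_\lambda(Q_2)-\overline{J}_\lambda(Q_1)-\overline{J}'_\lambda(Q_1)(Q_2-Q_1)\ge C_3e^{-2\lambda b}\|Q_2-Q_1\|^2_{H^2(0,b)},$$ where $\overline{J}'_\lambda(Q_1)$ is the Fréchet derivative of $\overline{J}_\lambda$ at $Q_1$.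
   Context: For a vector function $Q=(q_0,\dots,q_{N-1})$, $\|Q\|_{H^2(0,b)}=(\sum_n\|q_n\|^2_{H^2(0,b)})^{1/2}$ and $|\cdot|$ is the Euclidean norm in $\mathbb{R}^N$. Nonlinearity: fix $\underline{s}>0$; let $L_n(s)=e^{-s/2}\sum_{k=0}^n(-1)^k\binom{n}{k}\frac{s^k}{k!}$ (Laguerre functions) and $f_n(s)=L_n(s-\underline{s})$ for $s>\underline{s}$. For $k,m,n\in\{0,\dots,N-1\}$, $$F_{kmn}=\int_{\underline{s}}^\infty 2sf_k(s)\Big(\int_s^\infty f_m(\tau)d\tau\int_s^\infty f_n(\tau)d\tau\Big)ds-\int_{\underline{s}}^\infty 2s^2f_k(s)f_m(s)\Big(\int_s^\infty f_n(\tau)d\tau\Big)ds,$$ and $F=(F_0,\dots,F_{N-1}):\mathbb{R}^N\to\mathbb{R}^N$, $F_k(Q')=\sum_{m,n=0}^{N-1}F_{kmn}q_m'q_n'$. The Fréchet derivative is taken with respect to perturbations $h\in H^2(0,b)$ with $h(0)=h'(0)=h'(b)=0$. *)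

(* Defs.v *)
From HB Require Import structures.
From mathcomp Require Import all_boot all_order all_algebra.
From mathcomp Require Import all_classical all_reals all_analysis.
Set Implicit Arguments. Unset Strict Implicit. Unset Printing Implicit Defensive.
Import Order.TTheory GRing.Theory Num.Theory.
Local Open Scope classical_set_scope.
Local Open Scope ring_scope.

Definition laguerre (R : realType) (n : nat) (s : R) : R :=
  expR (- s / 2) *
  \sum_(k < n.+1) ((-1) ^+ k * ('C(n, k))%:R * s ^+ k / (k`!)%:R).

Definition flag (R : realType) (sbar : R) (n : nat) (s : R) : R :=
  laguerre n (s - sbar).

Definition tailint (R : realType) (sbar : R) (m : nat) (s : R) : R :=
  Rintegral (@lebesgue_measure R) `[s, +oo[ (flag sbar m).

Definition Fcoef (R : realType) (sbar : R) (k m n : nat) : R :=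
  Rintegral (@lebesgue_measure R) `[sbar, +oo[
    (fun s => 2 * s * flag sbar k s * (tailint sbar m s * tailint sbar n s))
  - Rintegral (@lebesgue_measure R) `[sbar, +oo[
    (fun s => 2 * s ^+ 2 * flag sbar k s * flag sbar m s * tailint sbar n s).

Definition Fvec (R : realType) (N : nat) (sbar : R) (v : 'I_N -> R) (k : 'I_N) : R :=
  \sum_(m < N) \sum_(n < N) Fcoef sbar k m n * v m * v n.

(* A vector function Q = (q_0..q_{N-1}) together with (representatives of)
   its first and second derivatives. *)
Record H2fun (R : realType) (N : nat) := mkH2 {
  h0 : 'I_N -> R -> R ;
  h1 : 'I_N -> R -> R ;
  h2 : 'I_N -> R -> R
}.

(* Q in H^2(0,b)^N : Q'' in L^2(0,b), Q' and Q absolutely continuous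
   primitives of Q'' and Q' respectively on [0,b]. *)
Definition isH2 (R : realType) (N : nat) (b : R) (Q : H2fun R N) : Prop :=
  forall i : 'I_N,
    measurable_fun `[0%R, b] (h2 Q i) /\
    (@lebesgue_measure R).-integrable `[0%R, b] (fun x => ((h2 Q i x) ^+ 2)%:E) /\
    (forall x : R, 0 <= x <= b ->
       h1 Q i x = h1 Q i 0 + Rintegral (@lebesgue_measure R) `[0%R, x] (h2 Q i) /\
       h0 Q i x = h0 Q i 0 + Rintegral (@lebesgue_measure R) `[0%R, x] (h1 Q i)).

Definition H2norm (R : realType) (N : nat) (b : R) (Q : H2fun R N) : R :=
  Num.sqrt (\sum_(i < N) Rintegral (@lebesgue_measure R) `[0%R, b]
     (fun x => h0 Q i x ^+ 2 + h1 Q i x ^+ 2 + h2 Q i x ^+ 2)).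

Definition addH2 (R : realType) (N : nat) (P Q : H2fun R N) : H2fun R N :=
  mkH2 (fun i x => h0 P i x + h0 Q i x) (fun i x => h1 P i x + h1 Q i x)
       (fun i x => h2 P i x + h2 Q i x).

Definition subH2 (R : realType) (N : nat) (P Q : H2fun R N) : H2fun R N :=
  mkH2 (fun i x => h0 P i x - h0 Q i x) (fun i x => h1 P i x - h1 Q i x)
       (fun i x => h2 P i x - h2 Q i x).

Definition scaleH2 (R : realType) (N : nat) (a : R) (Q : H2fun R N) : H2fun R N :=
  mkH2 (fun i x => a * h0 Q i x) (fun i x => a * h1 Q i x) (fun i x => a * h2 Q i x).

Definition Jbar (R : realType) (N : nat) (sbar b lam : R) (Q : H2fun R N) : R :=
  Rintegral (@lebesgue_measure R) `[0%R, b]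
    (fun x => (\sum_(k < N) (h2 Q k x + Fvec sbar (fun m => h1 Q m x) k) ^+ 2)
              * (expR (- lam * x)) ^+ 2).

Definition H0adm (R : realType) (N : nat) (b : R) (h : H2fun R N) : Prop :=
  isH2 b h /\ forall i, h0 h i 0 = 0 /\ h1 h i 0 = 0 /\ h1 h i b = 0.

Definition is_frechet_deriv (R : realType) (N : nat) (b : R)
    (J : H2fun R N -> R) (Q : H2fun R N) (L : H2fun R N -> R) : Prop :=
  (forall (a : R) u v, H0adm b u -> H0adm b v ->
      L (addH2 (scaleH2 a u) v) = a * L u + L v) /\
  (exists M : R, forall h, H0adm b h -> `|L h| <= M * H2norm b h) /\
  (forall eps : R, 0 < eps -> exists delta : R, 0 < delta /\
     forall h, H0adm b h -> H2norm b h < delta ->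
       `|J (addH2 Q h) - J Q - L h| <= eps * H2norm b h).

Definition G1 (R : realType) (N : nat) (b Rr : R) (Phi0 Psi0 Psib : 'I_N -> R)
    (Q : H2fun R N) : Prop :=
  isH2 b Q /\ H2norm b Q < Rr /\
  forall i, h0 Q i 0 = Phi0 i /\ h1 Q i 0 = Psi0 i /\ h1 Q i b = Psib i.

(* Main.v *)
(* Put p = h' and E = int |p'|^2 phi^2. Since p(0) = 0, writing
   p' = (p' e^(-lam t)) e^(lam t) and applying Cauchy-Schwarz gives the Carleman-type bound
   |p(x)|^2 phi(x)^2 <= E / (2 lam), with no integration by parts.
   With r = Q1'' + F(Q1') and B the derivative of F at Q1', the Bregman remainder is
   int (2 r . F(p) + |p' + B p + F(p)|^2) phi^2; it is at least
   E / 2 - (E / (2 lam)) (C int |r| + C'), hence at least E / 4 for large lam, because r is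
   bounded in L^1 and Q1', p are bounded uniformly over G1. Finally E >= e^(-2 lam b) int |p'|^2,
   and int |p'|^2 controls the H^2 norm of h because h(0) = h'(0) = 0. *)
Require Import Defs.
From HB Require Import structures.
From mathcomp Require Import all_boot all_order all_algebra.
From mathcomp Require Import all_classical all_reals all_analysis.
From mathcomp Require Import measurable_realfun ring lra.
Set Implicit Arguments. Unset Strict Implicit. Unset Printing Implicit Defensive.
Import Order.TTheory GRing.Theory Num.Theory.
Import numFieldNormedType.Exports.
Local Open Scope classical_set_scope.
Local Open Scope ring_scope.

(** * Square-integrable functions *)

Section square_integrable.
Context d (T : measurableType d) (R : realType) (mu : {measure set T -> \bar R}).
Context (D : set T) (mD : measurable D).
Implicit Types f g : T -> R.

(** Measurability of [f] is a separate clause because that of [f ^+ 2] does not imply it. *)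
Definition sqint f := measurable_fun D f /\ mu.-integrable D (EFin \o (fun x => f x ^+ 2)).

(** These functions serve as multipliers of [sqint]; [h0], [h1], the weight and the nonlinear terms
    all fall into this class on [[0, b]]. *)
Definition bmeas f := measurable_fun D f /\ exists M, forall x, D x -> `|f x| <= M.

Lemma integrableDR f g : mu.-integrable D (EFin \o f) ->
  mu.-integrable D (EFin \o g) -> mu.-integrable D (EFin \o (fun x => f x + g x)).
Proof. by move=> If Ig; exact: (integrableD mD If Ig). Qed.

Lemma integrableZR (a : R) f : mu.-integrable D (EFin \o f) ->
  mu.-integrable D (EFin \o (fun x => a * f x)).
Proof. by move=> If; exact: (integrableZl mD a If). Qed.

Lemma integrable_sumR I (r : seq I) (f : I -> T -> R) :
  (forall i, mu.-integrable D (EFin \o f i)) ->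
  mu.-integrable D (EFin \o (fun x => \sum_(i <- r) f i x)).
Proof.
move=> If.
have := @integrable_sum _ _ _ mu D mD I r xpredT (fun i => EFin \o f i) (fun i _ => If i).
by apply: eq_integrable => // x _; rewrite /= sumEFin.
Qed.

Lemma Rintegral_sum I (r : seq I) (f : I -> T -> R) :
  (forall i, mu.-integrable D (EFin \o f i)) ->
  Rintegral mu D (fun x => \sum_(i <- r) f i x) = \sum_(i <- r) Rintegral mu D (f i).
Proof.
move=> If; elim: r => [|i r IH].
  rewrite big_nil; under eq_Rintegral do rewrite big_nil.
  by rewrite Rintegral_cst // mul0r.
rewrite big_cons; under eq_Rintegral do rewrite big_cons.
by rewrite RintegralD ?IH//; exact: integrable_sumR.
Qed.

Lemma le_integrableR f g : measurable_fun D f ->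
  (forall x, D x -> `|f x| <= g x) -> mu.-integrable D (EFin \o g) ->
  mu.-integrable D (EFin \o f).
Proof.
move=> mf fg; apply: (le_integrable mD); first exact/measurable_EFinP.
by move=> x Dx; rewrite /= lee_fin (le_trans (fg x Dx))// ler_norm.
Qed.

(** The product is dominated pointwise by [f ^+ 2 + g ^+ 2]. *)
Lemma sqint_mul f g : sqint f -> sqint g -> mu.-integrable D (EFin \o (fun x => f x * g x)).
Proof.
move=> [mf If] [mg Ig]; apply: (le_integrableR _ _ (integrableDR If Ig)).
  exact: measurable_funM.
move=> x _; rewrite ler_norml; apply/andP; split; nra.
Qed.

Lemma sqintD f g : sqint f -> sqint g -> sqint (fun x => f x + g x).
Proof.
move=> sf sg; have Ifg := sqint_mul sf sg; case: sf sg => [mf If] [mg Ig].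
split; first exact: measurable_funD.
have := integrableDR (integrableDR If (integrableZR 2 Ifg)) Ig.
by apply: eq_integrable => // x _; rewrite /=; congr EFin; ring.
Qed.

Lemma sqintZ (a : R) f : sqint f -> sqint (fun x => a * f x).
Proof.
move=> [mf If]; split; first exact: measurable_funM.
have := integrableZR (a ^+ 2) If.
by apply: eq_integrable => // x _; rewrite /= exprMn.
Qed.

Lemma sqint_bmeas f g : sqint f -> bmeas g -> sqint (fun x => f x * g x).
Proof.
move=> [mf If] [mg [M gM]]; split; first exact: measurable_funM.
apply: (le_integrableR _ _ (integrableZR (M ^+ 2) If)).
  by apply: measurable_funX; exact: measurable_funM.
move=> x Dx; rewrite normrX normrM exprMn real_normK ?num_real// mulrC.
by rewrite ler_wpM2r ?sqr_ge0// lerXn2r ?nnegrE// ?gM// (le_trans _ (gM x Dx)).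
Qed.

Lemma bmeas_cst (a : R) : bmeas (fun=> a).
Proof. by split=> //; exists `|a|. Qed.

Lemma bmeasD f g : bmeas f -> bmeas g -> bmeas (fun x => f x + g x).
Proof.
move=> [mf [M fM]] [mg [M' gM]]; split; first exact: measurable_funD.
by exists (M + M') => x Dx; rewrite (le_trans (ler_normD _ _))// lerD ?fM ?gM.
Qed.

Lemma bmeasM f g : bmeas f -> bmeas g -> bmeas (fun x => f x * g x).
Proof.
move=> [mf [M fM]] [mg [M' gM]]; split; first exact: measurable_funM.
by exists (M * M') => x Dx; rewrite normrM ler_pM ?fM ?gM.
Qed.

Lemma bmeas_sum I (r : seq I) (f : I -> T -> R) : (forall i, bmeas (f i)) ->
  bmeas (fun x => \sum_(i <- r) f i x).
Proof.
move=> bf; elim: r => [|i r IH].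
  by under [X in bmeas X]funext do rewrite big_nil; exact: bmeas_cst.
under [X in bmeas X]funext do rewrite big_cons.
exact: bmeasD.
Qed.

Hypothesis finD : (mu D < +oo)%E.

Lemma bmeas_integrable f : bmeas f -> mu.-integrable D (EFin \o f).
Proof.
move=> [mf [M fM]]; apply: measurable_bounded_integrable => //.
by exists M; split; rewrite ?num_real// => x Mx y Dy /=; rewrite (le_trans (fM y Dy))// ltW.
Qed.

Lemma bmeas_sqint f : bmeas f -> sqint f.
Proof.
move=> bf; split; first by case: bf.
by under [X in _.-integrable _ (EFin \o X)]funext do rewrite expr2; exact/bmeas_integrable/bmeasM.
Qed.

Lemma sqint_integrable f : sqint f -> mu.-integrable D (EFin \o f).
Proof.
move=> sf; have := sqint_mul sf (bmeas_sqint (bmeas_cst 1)).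
by apply: eq_integrable => // x _; rewrite /= mulr1.
Qed.

End square_integrable.

(** Discriminant argument: the integral of [(t * f + g) ^+ 2] is a quadratic polynomial in [t] that
    is nowhere negative. *)
Lemma Cauchy_Schwarz_Rintegral d (T : measurableType d) (R : realType)
    (mu : {measure set T -> \bar R}) (D : set T) (f g : T -> R) :
  measurable D -> sqint mu D f -> sqint mu D g ->
  Rintegral mu D (fun x => f x * g x) ^+ 2 <=
    Rintegral mu D (fun x => f x ^+ 2) * Rintegral mu D (fun x => g x ^+ 2).
Proof.
move=> mD sf sg; have Ifg := sqint_mul mD sf sg; have [_ If] := sf; have [_ Ig] := sg.
set A := Rintegral mu D (fun x => f x ^+ 2).
set B := Rintegral mu D _; set C := Rintegral mu D _.
have quad t : 0 <= t ^+ 2 * A + 2 * t * B + C.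
  have -> : t ^+ 2 * A + 2 * t * B + C = Rintegral mu D (fun x => (t * f x + g x) ^+ 2).
    rewrite /A /B /C -!RintegralZl// -!RintegralD//.
    - by apply: eq_Rintegral => x _; ring.
    - by apply: integrableDR => //; exact: integrableZR.
    - exact: integrableZR.
    - exact: integrableZR.
  by apply: Rintegral_ge0 => x _; exact: sqr_ge0.
have A0 : 0 <= A by apply: Rintegral_ge0 => x _; exact: sqr_ge0.
have [A00|An0] := eqVneq A 0; last first.
  have Ap : 0 < A by rewrite lt_def An0.
  (* The minimiser of the quadratic, where its value is [(A * C - B ^+ 2) / A]. *)
  have := quad (- B / A).
  have -> : (- B / A) ^+ 2 * A + 2 * (- B / A) * B + C = (A * C - B ^+ 2) / A by field.
  by rewrite pmulr_lge0 ?invr_gt0// subr_ge0.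
rewrite A00 mul0r.
have [->|Bn0] := eqVneq B 0; first by rewrite expr0n.
(* With [A = 0] the polynomial is affine in [t]; for [B != 0] this [t] gives it the value [-1], a
   contradiction. *)
have := quad (- (C + 1) / (2 * B)); rewrite A00.
have -> : (- (C + 1) / (2 * B)) ^+ 2 * 0 + 2 * (- (C + 1) / (2 * B)) * B + C = -1 by field.
by rewrite ler0N1.
Qed.

(** * Primitives on an interval *)

Section interval.
Context (R : realType).
Notation mu := (@lebesgue_measure R).
Implicit Types (f g : R -> R) (x y : R).

Lemma itv_lty x y : (mu `[x, y] < +oo)%E.
Proof. by rewrite lebesgue_measure_itv; case: ifP => _; rewrite ?ltry// -EFinD ltry. Qed.

Lemma Rintegral_itv_cst (c x : R) : 0 <= x -> Rintegral mu `[0, x] (fun=> c) = c * x.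
Proof.
move=> x0; rewrite Rintegral_cst//; congr (_ * _).
have E : mu `[0, x] = x%:E.
  rewrite lebesgue_measure_itv/= lte_fin.
  by case: ltgtP x0 => //= [_|<-]; rewrite ?oppr0 ?adde0.
exact: (congr1 fine E).
Qed.

Lemma le_Rintegral_itv f x b : x <= b -> (forall t, 0 <= f t) ->
  mu.-integrable `[0, b] (EFin \o f) ->
  Rintegral mu `[0, x] f <= Rintegral mu `[0, b] f.
Proof.
move=> xb f0 If; have sub : (`[0, x] `<=` `[0, b]) by apply: subset_itvl; rewrite bnd_simp.
rewrite /Rintegral fine_le//.
- by apply: integrable_fin_num => //; exact: integrableS If.
- exact: integrable_fin_num.
- by apply: ge0_subset_integral => //; [case/integrableP: If|move=> t _; rewrite lee_fin].
Qed.

Lemma bmeas_continuous f x y : continuous f -> bmeas `[x, y] f.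
Proof.
move=> cf; have cfI : {within `[x, y], continuous f} by exact: continuous_subspaceT.
split; first exact: subspace_continuous_measurable_fun.
have [M [_ fM]] := compact_bounded (continuous_compact cfI (@segment_compact _ x y)).
(* Boundedness is stated for every real strictly above [M], hence the shift by 1. *)
by exists (M + 1) => t It; apply: (fM (M + 1)); [rewrite ltrDl|exists t].
Qed.

Lemma bmeas_expR (a : R) x y : bmeas `[x, y] (fun t => expR (a * t)).
Proof.
apply: bmeas_continuous => t; apply: continuous_comp; last exact: continuous_expR.
exact: mulrl_continuous.
Qed.

Lemma sqint_itv_sub f x b : x <= b -> sqint mu `[0, b] f -> sqint mu `[0, x] f.
Proof.
move=> xb [mf If]; have sub : (`[0, x] `<=` `[0, b]) by apply: subset_itvl; rewrite bnd_simp.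
by split; [exact: measurable_funS mf|exact: integrableS If].
Qed.

Lemma Rintegral_expR_le (a x : R) : 0 < a -> 0 <= x ->
  Rintegral mu `[0, x] (fun t => expR (a * t)) <= expR (a * x) / a.
Proof.
(* The degenerate interval is treated apart, since the fundamental theorem of calculus is applied on
   an interval with [0 < x]. *)
move=> a0; rewrite le_eqVlt => /predU1P[<-|x0].
  by rewrite set_itv1 Rintegral_set1 divr_ge0 ?expR_ge0// ltW.
pose F (t : R) : R := expR (a * t) / a.
have dF t : is_derive (t : R) 1 F (expR (a * t)).
  rewrite /F; apply: is_derive_eq; rewrite /GRing.scale/=; field.
  exact: lt0r_neq0.
have cF : continuous F.
  by move=> t; apply: differentiable_continuous; apply/derivable1_diffP; case: (dF t).
rewrite /Rintegral (@continuous_FTC2 _ _ F)//.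
- by rewrite /= /F mulr0 expR0 lerBlDr lerDl divr_ge0// ltW.
- apply: continuous_subspaceT => t; apply: continuous_comp; last exact: continuous_expR.
  exact: mulrl_continuous.
- split.
  + by move=> t _; case: (dF t).
  + by apply: cvg_at_right_filter; exact: cF.
  + by apply: cvg_at_left_filter; exact: cF.
- by move=> t _; rewrite derive1E; case: (dF t).
Qed.

(* Cauchy-Schwarz applied to [g e^(-a t)] and [e^(a t)]. *)
Lemma sqr_primitive_le_weighted g (a b x : R) : 0 < a -> 0 <= x <= b ->
  sqint mu `[0, b] g ->
  Rintegral mu `[0, x] g ^+ 2 * expR (- a * x) ^+ 2 <=
    Rintegral mu `[0, b] (fun t => (g t * expR (- a * t)) ^+ 2) / (2 * a).
Proof.
move=> a0 /andP[x0 xb] sg.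
have sge z : z <= b -> sqint mu `[0, z] (fun t => g t * expR (- a * t)).
  by move=> zb; apply: sqint_bmeas => //; [exact: sqint_itv_sub sg|exact: bmeas_expR].
have se : sqint mu `[0, x] (fun t => expR (a * t)).
  by apply: bmeas_sqint => //; [exact: itv_lty|exact: bmeas_expR].
have := @Cauchy_Schwarz_Rintegral _ _ _ mu _ _ _ (measurable_itv _) (sge x xb) se.
have -> : Rintegral mu `[0, x] (fun t => g t * expR (- a * t) * expR (a * t)) =
    Rintegral mu `[0, x] g.
  by apply: eq_Rintegral => t _; rewrite -mulrA -expRD mulNr addNr expR0 mulr1.
have -> : Rintegral mu `[0, x] (fun t => expR (a * t) ^+ 2) =
    Rintegral mu `[0, x] (fun t => expR (2 * a * t)).
  by apply: eq_Rintegral => t _; rewrite -expRM_natl mulrA.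
move=> CS; rewrite (le_trans (ler_wpM2r _ CS)) ?sqr_ge0//.
(* The weight at [x] cancels the growth [expR (2 * a * x) / (2 * a)] of the second Cauchy-Schwarz
   factor, which leaves [1 / (2 * a)] uniformly in [x]. *)
have -> : expR (- a * x) ^+ 2 = (expR (2 * a * x))^-1.
  by rewrite -expRM_natl -expRN; congr expR; ring.
rewrite ler_pdivrMr ?expR_gt0// -[leRHS]mulrA ler_pM//.
- by apply: Rintegral_ge0 => t _; exact: sqr_ge0.
- by apply: Rintegral_ge0 => t _; exact: expR_ge0.
- by apply: le_Rintegral_itv => // [t|]; [exact: sqr_ge0|case: (sge b (lexx b))].
- by rewrite [leRHS]mulrC; apply: Rintegral_expR_le => //; lra.
Qed.

(** Cauchy-Schwarz against the constant 1; the unweighted counterpart, behind the Poincaré-type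
    bounds on [h0] and [h1]. *)
Lemma sqr_primitive_le g (b x : R) : 0 <= x <= b -> sqint mu `[0, b] g ->
  Rintegral mu `[0, x] g ^+ 2 <= b * Rintegral mu `[0, b] (fun t => g t ^+ 2).
Proof.
move=> /andP[x0 xb] sg.
have s1 : sqint mu `[0, x] (fun=> 1 : R).
  by apply: bmeas_sqint => //; [exact: itv_lty|exact: bmeas_cst].
have := @Cauchy_Schwarz_Rintegral _ _ _ mu _ _ _ (measurable_itv _) (sqint_itv_sub xb sg) s1.
under eq_Rintegral do rewrite mulr1.
move=> /le_trans; apply; rewrite mulrC ler_pM//.
- by apply: Rintegral_ge0 => t _; exact: sqr_ge0.
- by apply: Rintegral_ge0 => t _; exact: sqr_ge0.
- by rewrite Rintegral_itv_cst// expr1n mul1r.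
- by apply: le_Rintegral_itv => // [t|]; [exact: sqr_ge0|case: sg].
Qed.

(** Integrates [|g| <= 1 + g ^+ 2]. *)
Lemma Rintegral_abs_le_sqr g (b : R) : 0 <= b -> sqint mu `[0, b] g ->
  Rintegral mu `[0, b] (fun t => `|g t|) <= b + Rintegral mu `[0, b] (fun t => g t ^+ 2).
Proof.
move=> b0 sg; have [_ Ig] := sg.
have I1 : mu.-integrable `[0, b] (EFin \o (fun=> 1 : R)).
  by apply: bmeas_integrable => //; [exact: itv_lty|exact: bmeas_cst].
rewrite -{2}[b]mul1r -Rintegral_itv_cst// -RintegralD//; apply: le_Rintegral => //.
- by apply: integrable_norm; apply: sqint_integrable => //; exact: itv_lty.
- exact: integrableDR.
- by move=> t _; rewrite -[g t ^+ 2]real_normK ?num_real//; nra.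
Qed.

Lemma measurable_primitive g (b : R) : 0 <= b -> mu.-integrable `[0, b] (EFin \o g) ->
  measurable_fun `[0, b] (fun x => Rintegral mu `[0, x] g).
Proof.
by move=> b0 Ig; apply: subspace_continuous_measurable_fun => //;
  exact: parameterized_integral_continuous.
Qed.

Lemma norm_primitive_le g (b x : R) : 0 <= x <= b -> mu.-integrable `[0, b] (EFin \o g) ->
  `|Rintegral mu `[0, x] g| <= Rintegral mu `[0, b] (fun t => `|g t|).
Proof.
move=> /andP[x0 xb] Ig; have sub : `[0, x] `<=` `[0, b] by apply: subset_itvl; rewrite bnd_simp.
apply: (le_trans (le_normr_Rintegral _ _)) => //; first exact: integrableS Ig.
by apply: le_Rintegral_itv => //; exact: integrable_norm.
Qed.

End interval.

(** * The quadratic nonlinearity and the space H2 *)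

Section bilinear.
Context (R : realType) (N : nat).
Implicit Types (c : 'I_N -> 'I_N -> R) (u v w : 'I_N -> R).

(** [Fvec sbar v k] is by conversion the diagonal value [bilin (Fk sbar k) v v]; separating the two
    arguments gives access to its polarisation. *)
Definition bilin c u v := \sum_(m < N) \sum_(n < N) c m n * u m * v n.

Lemma bilinDl c u v w : bilin c (fun i => u i + v i) w = bilin c u w + bilin c v w.
Proof.
rewrite -big_split; apply: eq_bigr => m _ /=; rewrite -big_split; apply: eq_bigr => n _ /=.
ring.
Qed.

Lemma bilinDr c u v w : bilin c w (fun i => u i + v i) = bilin c w u + bilin c w v.
Proof.
rewrite -big_split; apply: eq_bigr => m _ /=; rewrite -big_split; apply: eq_bigr => n _ /=.
ring.
Qed.

Lemma bilinZl c a u w : bilin c (fun i => a * u i) w = a * bilin c u w.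
Proof.
rewrite mulr_sumr; apply: eq_bigr => m _ /=; rewrite mulr_sumr; apply: eq_bigr => n _ /=.
ring.
Qed.

Lemma bilinZr c a u w : bilin c w (fun i => a * u i) = a * bilin c w u.
Proof.
rewrite mulr_sumr; apply: eq_bigr => m _ /=; rewrite mulr_sumr; apply: eq_bigr => n _ /=.
ring.
Qed.

Lemma bilin_le c u v (K U V : R) : \sum_(m < N) \sum_(n < N) `|c m n| <= K ->
  0 <= U -> 0 <= V ->
  (forall i, `|u i| <= U) -> (forall i, `|v i| <= V) -> `|bilin c u v| <= K * U * V.
Proof.
move=> cK U0 V0 uU vV; rewrite -mulrA; apply: le_trans (ler_wpM2r (mulr_ge0 U0 V0) cK).
rewrite mulr_suml; apply: le_trans (ler_norm_sum _ _ _) _; apply: ler_sum => m _.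
rewrite mulr_suml; apply: le_trans (ler_norm_sum _ _ _) _; apply: ler_sum => n _.
by rewrite -mulrA !normrM ler_wpM2l// ler_pM.
Qed.

Lemma bilin_bmeas d (T : measurableType d) (D : set T) c (u v : 'I_N -> T -> R) :
  (forall i, bmeas D (u i)) -> (forall i, bmeas D (v i)) ->
  bmeas D (fun x => bilin c (fun i => u i x) (fun i => v i x)).
Proof.
move=> bu bv; apply: bmeas_sum => m; apply: bmeas_sum => n.
by apply: bmeasM => //; apply: bmeasM => //; exact: bmeas_cst.
Qed.

End bilinear.

(** Expanding [(d + 2 * B) ^+ 2 >= 0] gives [(d + B) ^+ 2 >= d ^+ 2 / 2 - B ^+ 2]. In the
    application [d] is [h''], [s] bounds [|h'|] at the point, [F] is the nonlinearity at [h'], and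
    [B] collects the lower-order terms. *)
Lemma sqr_remainder_ge (R : realFieldType) (r d B F K T s : R) : 0 <= T * s ->
  `|F| <= K * s ^+ 2 -> `|B| <= T * s ->
  d ^+ 2 / 2 - 2 * K * s ^+ 2 * `|r| - T ^+ 2 * s ^+ 2 <= 2 * r * F + (d + B) ^+ 2.
Proof.
move=> Ts FK BT.
have rF : - (`|r| * (K * s ^+ 2)) <= r * F.
  rewrite lerNl (le_trans (ler_norm _))// normrN normrM ler_wpM2l//.
have B2 : B ^+ 2 <= (T * s) ^+ 2 by rewrite -[B ^+ 2]real_normK ?num_real// lerXn2r ?nnegrE.
have := sqr_ge0 (d + 2 * B); nra.
Qed.

(** Here [(d - B) ^+ 2 >= 0] gives [(d + B) ^+ 2 <= 2 * d ^+ 2 + 2 * B ^+ 2]. *)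
Lemma sqr_remainder_le (R : realFieldType) (r d B F K T s : R) : 0 <= T * s ->
  `|F| <= K * s ^+ 2 -> `|B| <= T * s ->
  `|2 * r * F + (d + B) ^+ 2| <= 2 * K * s ^+ 2 * `|r| + 2 * d ^+ 2 + 2 * T ^+ 2 * s ^+ 2.
Proof.
move=> Ts FK BT.
have rF : `|r * F| <= `|r| * (K * s ^+ 2) by rewrite normrM ler_wpM2l.
have B2 : B ^+ 2 <= (T * s) ^+ 2 by rewrite -[B ^+ 2]real_normK ?num_real// lerXn2r ?nnegrE.
rewrite (le_trans (ler_normD _ _))// -mulrA normrM ger0_norm// [`|_ ^+ 2|]ger0_norm ?sqr_ge0//.
have := sqr_ge0 (d - B); nra.
Qed.

(** * Sup-norm and Poincaré-type estimates for [H2] functions *)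

Section H2.
Context (R : realType) (N : nat) (b : R) (b0 : 0 < b).
Notation mu := (@lebesgue_measure R).
Implicit Types (Q P h : H2fun R N) (i : 'I_N).

Lemma isH2_sqint Q i : isH2 b Q -> sqint mu `[0, b] (h2 Q i).
Proof. by move=> /(_ i)[? []]. Qed.

Lemma isH2_integrable2 Q i : isH2 b Q -> mu.-integrable `[0, b] (EFin \o h2 Q i).
Proof. by move=> HQ; apply: sqint_integrable (isH2_sqint i HQ) => //; exact: itv_lty. Qed.

(** A primitive of an integrable function is continuous, hence measurable, and is bounded through
    the L1 norm. It is used for [h1] over [h2], then for [h0] over [h1]. *)
Lemma primitive_bmeas (f g : R -> R) (a : R) : mu.-integrable `[0, b] (EFin \o f) ->
  (forall x, 0 <= x <= b -> g x = a + Rintegral mu `[0, x] f) -> bmeas `[0, b] g.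
Proof.
move=> If gE; split.
  have := measurable_funD (@measurable_cst _ _ _ _ `[0, b] a) (measurable_primitive (ltW b0) If).
  by apply: eq_measurable_fun => x; rewrite inE/= in_itv/= => /gE ->.
exists (`|a| + Rintegral mu `[0, b] (fun t => `|f t|)) => x; rewrite /= in_itv/= => xI.
by rewrite gE// (le_trans (ler_normD _ _))// lerD2l norm_primitive_le.
Qed.

Lemma isH2_bmeas1 Q i : isH2 b Q -> bmeas `[0, b] (h1 Q i).
Proof.
move=> HQ; apply: (primitive_bmeas (isH2_integrable2 i HQ) (a := h1 Q i 0)).
by move=> x xI; have [_ [_ /(_ x xI)[]]] := HQ i.
Qed.

Lemma isH2_sqint1 Q i : isH2 b Q -> sqint mu `[0, b] (h1 Q i).
Proof.
by move=> HQ; apply: bmeas_sqint => //; [exact: itv_lty|exact: isH2_bmeas1].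
Qed.

Lemma isH2_sqint0 Q i : isH2 b Q -> sqint mu `[0, b] (h0 Q i).
Proof.
move=> HQ; apply: bmeas_sqint => //; first exact: itv_lty.
have I1 : mu.-integrable `[0, b] (EFin \o h1 Q i).
  by apply: sqint_integrable (isH2_sqint1 i HQ) => //; exact: itv_lty.
by apply: (primitive_bmeas I1 (a := h0 Q i 0)) => x xI; have [_ [_ /(_ x xI)[]]] := HQ i.
Qed.

(** On [G1] both terms on the right are controlled by the data, so this becomes a sup bound uniform
    over the set. *)
Lemma isH2_h1_le Q i x : isH2 b Q -> 0 <= x <= b ->
  `|h1 Q i x| <= `|h1 Q i 0| + (b + Rintegral mu `[0, b] (fun t => h2 Q i t ^+ 2)).
Proof.
move=> HQ xI; have [_ [_ /(_ x xI)[-> _]]] := HQ i.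
rewrite (le_trans (ler_normD _ _))// lerD2l.
rewrite (le_trans (norm_primitive_le xI (isH2_integrable2 i HQ)))//.
exact: Rintegral_abs_le_sqr (ltW b0) (isH2_sqint i HQ).
Qed.

Lemma isH2_h1_weighted h i x (lam : R) : isH2 b h -> h1 h i 0 = 0 -> 0 < lam -> 0 <= x <= b ->
  h1 h i x ^+ 2 * expR (- lam * x) ^+ 2 <=
    Rintegral mu `[0, b] (fun t => (h2 h i t * expR (- lam * t)) ^+ 2) / (2 * lam).
Proof.
move=> Hh h10 lam0 xI; have [_ [_ /(_ x xI)[-> _]]] := Hh i; rewrite h10 add0r.
exact: sqr_primitive_le_weighted lam0 xI (isH2_sqint i Hh).
Qed.

Lemma isH2_sqr_h1_le h i x : isH2 b h -> h1 h i 0 = 0 -> 0 <= x <= b ->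
  h1 h i x ^+ 2 <= b * Rintegral mu `[0, b] (fun t => h2 h i t ^+ 2).
Proof.
move=> Hh h10 xI; have [_ [_ /(_ x xI)[-> _]]] := Hh i; rewrite h10 add0r.
exact: sqr_primitive_le xI (isH2_sqint i Hh).
Qed.

Lemma isH2_sqr_h0_le h i x : isH2 b h -> h0 h i 0 = 0 -> 0 <= x <= b ->
  h0 h i x ^+ 2 <= b * Rintegral mu `[0, b] (fun t => h1 h i t ^+ 2).
Proof.
move=> Hh h00 xI; have [_ [_ /(_ x xI)[_ ->]]] := Hh i; rewrite h00 add0r.
exact: sqr_primitive_le xI (isH2_sqint1 i Hh).
Qed.

Lemma H2norm_ge0 Q : 0 <= H2norm b Q. Proof. exact: sqrtr_ge0. Qed.

Lemma sqr_H2norm Q : H2norm b Q ^+ 2 = \sum_(i < N) Rintegral mu `[0, b]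
  (fun x => h0 Q i x ^+ 2 + h1 Q i x ^+ 2 + h2 Q i x ^+ 2).
Proof.
rewrite sqr_sqrtr//; apply: sumr_ge0 => i _; apply: Rintegral_ge0 => x _.
by rewrite !addr_ge0 ?sqr_ge0.
Qed.

Lemma Rintegral_H2 Q i : isH2 b Q -> Rintegral mu `[0, b]
  (fun x => h0 Q i x ^+ 2 + h1 Q i x ^+ 2 + h2 Q i x ^+ 2) =
  Rintegral mu `[0, b] (fun x => h0 Q i x ^+ 2) + Rintegral mu `[0, b] (fun x => h1 Q i x ^+ 2)
  + Rintegral mu `[0, b] (fun x => h2 Q i x ^+ 2).
Proof.
move=> HQ; have [_ I0] := isH2_sqint0 i HQ; have [_ I1] := isH2_sqint1 i HQ.
have [_ I2] := isH2_sqint i HQ.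
by rewrite RintegralD ?RintegralD//; exact: integrableDR.
Qed.

Lemma sum_Rintegral_h2_le Q : isH2 b Q ->
  \sum_(i < N) Rintegral mu `[0, b] (fun x => h2 Q i x ^+ 2) <= H2norm b Q ^+ 2.
Proof.
move=> HQ; rewrite sqr_H2norm; apply: ler_sum => i _; rewrite Rintegral_H2// lerDr.
by apply: addr_ge0; apply: Rintegral_ge0 => x _; exact: sqr_ge0.
Qed.

Lemma Rintegral_h2_le Q i : isH2 b Q ->
  Rintegral mu `[0, b] (fun x => h2 Q i x ^+ 2) <= H2norm b Q ^+ 2.
Proof.
move=> HQ; apply: le_trans (sum_Rintegral_h2_le HQ).
rewrite (bigD1 i)//= lerDl; apply: sumr_ge0 => j _.
by apply: Rintegral_ge0 => x _; exact: sqr_ge0.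
Qed.

Lemma le_Rintegral_sup (f : R -> R) (M : R) : mu.-integrable `[0, b] (EFin \o f) ->
  (forall x, 0 <= x <= b -> f x <= M) -> Rintegral mu `[0, b] f <= b * M.
Proof.
move=> If fM; rewrite mulrC -Rintegral_itv_cst ?(ltW b0)//; apply: le_Rintegral => //.
by apply: bmeas_integrable => //; [exact: itv_lty|exact: bmeas_cst].
Qed.

(** Two Poincaré-type steps from the zero data at 0: the squared L2 norm of [h1] is at most [b ^+ 2]
    times that of [h2], and that of [h0] at most [b ^+ 2] times that of [h1]. *)
Lemma sqr_H2norm_le h : H0adm b h ->
  H2norm b h ^+ 2 <= (1 + b ^+ 2 + b ^+ 4) *
    \sum_(i < N) Rintegral mu `[0, b] (fun x => h2 h i x ^+ 2).
Proof.
move=> [Hh hz]; rewrite sqr_H2norm mulr_sumr; apply: ler_sum => i _.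
have [h00 [h10 _]] := hz i; rewrite Rintegral_H2//.
have [_ I0] := isH2_sqint0 i Hh; have [_ I1] := isH2_sqint1 i Hh.
have := le_Rintegral_sup I1 (fun x => isH2_sqr_h1_le Hh h10).
have := le_Rintegral_sup I0 (fun x => isH2_sqr_h0_le Hh h00).
set A := Rintegral _ _ _; set B := Rintegral _ _ _; set C := Rintegral _ _ _ => AB BC.
(* Chaining the two steps produces the [b ^+ 4] term. *)
have : b * (b * B) <= b * (b * (b * (b * C))) by rewrite !ler_wpM2l ?(ltW b0).
nra.
Qed.

(** One closure property covers linearity of the derivative, sums ([a = 1]) and differences
    ([a = -1]). *)
Lemma isH2_scale_add a P Q : isH2 b P -> isH2 b Q -> isH2 b (addH2 (scaleH2 a P) Q).
Proof.
move=> HP HQ i; have sP := isH2_sqint i HP; have sQ := isH2_sqint i HQ.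
have [mS IS] : sqint mu `[0, b] (fun x => a * h2 P i x + h2 Q i x).
  by apply: sqintD => //; exact: sqintZ.
split=> //; split=> // x xI /=.
have [_ [_ /(_ x xI)[P1 P0]]] := HP i; have [_ [_ /(_ x xI)[Q1 Q0]]] := HQ i.
have sub : `[0, x] `<=` `[0, b].
  by apply: subset_itvl; rewrite bnd_simp; case/andP: xI.
have xint (f : R -> R) : sqint mu `[0, b] f -> mu.-integrable `[0, x] (EFin \o f).
  move=> sf; have : mu.-integrable `[0, b] (EFin \o f).
    by apply: sqint_integrable => //; exact: itv_lty.
  exact: integrableS.
have lin (f g : R -> R) : sqint mu `[0, b] f -> sqint mu `[0, b] g ->
    Rintegral mu `[0, x] (fun t => a * f t + g t) =
    a * Rintegral mu `[0, x] f + Rintegral mu `[0, x] g.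
  move=> /xint If /xint Ig; rewrite RintegralD//; first by rewrite RintegralZl.
  exact: integrableZR.
split.
- by rewrite lin// P1 Q1; ring.
- by rewrite lin ?P0 ?Q0; [ring|exact: isH2_sqint1|exact: isH2_sqint1].
Qed.

End H2.

(** * Expansion of the functional *)

Section functional.
Context (R : realType) (N : nat) (sbar b lam : R) (b0 : 0 < b) (lam0 : 0 < lam).
Notation mu := (@lebesgue_measure R).
Implicit Types (Q P h u v : H2fun R N) (i k : 'I_N).

Definition Fk k := fun m n : 'I_N => Fcoef sbar k m n.

Definition residual Q k x := h2 Q k x + Fvec sbar (fun m => h1 Q m x) k.

(** Derivative at [Q'] of the quadratic map in the direction [h']. Both orders of the arguments
    appear because [Fcoef] is not assumed symmetric in its last two indices. *)
Definition dF Q h k x := bilin (Fk k) (fun m => h1 Q m x) (fun m => h1 h m x)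
  + bilin (Fk k) (fun m => h1 h m x) (fun m => h1 Q m x).

Definition dresidual Q h k x := h2 h k x + dF Q h k x.

Definition weight (x : R) := expR (- lam * x) ^+ 2.

Definition Jderiv Q h := \sum_(k < N) Rintegral mu `[0, b]
  (fun x => 2 * residual Q k x * dresidual Q h k x * weight x).

(** With [r] the residual, [D] its linearisation and [F] the nonlinearity at [h'], this is [(r + D +
    F)^2 - r^2 - 2 r D = 2 r F + (D + F)^2]. The grouping isolates [h2] from the lower-order
    terms. *)
Definition remainder Q h k x := 2 * residual Q k x * Fvec sbar (fun m => h1 h m x) k
  + (h2 h k x + (dF Q h k x + Fvec sbar (fun m => h1 h m x) k)) ^+ 2.

Lemma weight_bmeas : bmeas `[0, b] weight.
Proof.
by under [X in bmeas _ X]funext do rewrite /weight expr2; apply: bmeasM; exact: bmeas_expR.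
Qed.

Lemma weight_ge0 x : 0 <= weight x. Proof. exact: sqr_ge0. Qed.

Lemma weight_gt0 x : 0 < weight x. Proof. by rewrite exprn_gt0 ?expR_gt0. Qed.

Lemma weight_le1 x : 0 <= x -> weight x <= 1.
Proof.
move=> x0; rewrite /weight -expRM_natl -expR0 ler_expR mulNr mulrN oppr_le0.
by rewrite !mulr_ge0// ltW.
Qed.

Lemma weight_ge x : x <= b -> expR (- (2 * lam * b)) <= weight x.
Proof.
move=> xb; rewrite /weight -expRM_natl ler_expR mulNr mulrN lerN2 mulrA ler_wpM2l//.
by rewrite mulr_ge0// ltW.
Qed.

Lemma integrable_mul_weight f g : sqint mu `[0, b] f -> sqint mu `[0, b] g ->
  mu.-integrable `[0, b] (EFin \o (fun x => f x * g x * weight x)).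
Proof.
move=> sf sg; have sgw : sqint mu `[0, b] (fun x => g x * weight x).
  by apply: sqint_bmeas => //; exact: weight_bmeas.
by have := @sqint_mul _ _ _ mu _ (measurable_itv _) _ _ sf sgw;
  apply: eq_integrable => // x _; rewrite /= mulrA.
Qed.

Lemma bilin_h1_bmeas k P Q : isH2 b P -> isH2 b Q ->
  bmeas `[0, b] (fun x => bilin (Fk k) (fun m => h1 P m x) (fun m => h1 Q m x)).
Proof. by move=> HP HQ; apply: bilin_bmeas => i; exact: isH2_bmeas1. Qed.

Lemma dF_bmeas Q h k : isH2 b Q -> isH2 b h -> bmeas `[0, b] (dF Q h k).
Proof. by move=> HQ Hh; apply: bmeasD; exact: bilin_h1_bmeas. Qed.

Lemma Fvec_sqint Q k : isH2 b Q -> sqint mu `[0, b] (fun x => Fvec sbar (fun m => h1 Q m x) k).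
Proof.
by move=> HQ; apply: bmeas_sqint => //; [exact: itv_lty|exact: (bilin_h1_bmeas k HQ HQ)].
Qed.

Lemma dF_sqint Q h k : isH2 b Q -> isH2 b h -> sqint mu `[0, b] (dF Q h k).
Proof. by move=> HQ Hh; apply: bmeas_sqint => //; [exact: itv_lty|exact: dF_bmeas]. Qed.

Lemma residual_sqint Q k : isH2 b Q -> sqint mu `[0, b] (residual Q k).
Proof. by move=> HQ; apply: sqintD => //; [exact: isH2_sqint|exact: Fvec_sqint]. Qed.

Lemma dresidual_sqint Q h k : isH2 b Q -> isH2 b h -> sqint mu `[0, b] (dresidual Q h k).
Proof. by move=> HQ Hh; apply: sqintD => //; [exact: isH2_sqint|exact: dF_sqint]. Qed.

Lemma integrable_residual_sqr Q k : isH2 b Q ->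
  mu.-integrable `[0, b] (EFin \o (fun x => residual Q k x ^+ 2 * weight x)).
Proof.
move=> HQ; have := integrable_mul_weight (residual_sqint k HQ) (residual_sqint k HQ).
by apply: eq_integrable => // x _; rewrite /= -expr2.
Qed.

Lemma Jbar_sum Q : isH2 b Q ->
  Jbar sbar b lam Q = \sum_(k < N) Rintegral mu `[0, b] (fun x => residual Q k x ^+ 2 * weight x).
Proof.
move=> HQ; rewrite -Rintegral_sum//; last by move=> k; exact: integrable_residual_sqr.
by apply: eq_Rintegral => x _; rewrite mulr_suml.
Qed.

Lemma integrable_Jderiv Q h k : isH2 b Q -> isH2 b h -> mu.-integrable `[0, b]
  (EFin \o (fun x => 2 * residual Q k x * dresidual Q h k x * weight x)).
Proof.
move=> HQ Hh; apply: integrable_mul_weight; last exact: dresidual_sqint.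
by apply: sqintZ => //; exact: residual_sqint.
Qed.

Lemma integrable_remainder Q h k : isH2 b Q -> isH2 b h ->
  mu.-integrable `[0, b] (EFin \o (fun x => remainder Q h k x * weight x)).
Proof.
move=> HQ Hh; have sF := Fvec_sqint k Hh.
have sG : sqint mu `[0, b] (fun x => h2 h k x + (dF Q h k x + Fvec sbar (fun m => h1 h m x) k)).
  by apply: sqintD => //; [exact: isH2_sqint|apply: sqintD => //; exact: dF_sqint].
have I1 := integrable_mul_weight (residual_sqint k HQ) sF.
have I2 := integrable_mul_weight sG sG.
have : mu.-integrable `[0, b] (EFin \o (fun x =>
    2 * (residual Q k x * Fvec sbar (fun m => h1 h m x) k * weight x) +
    (h2 h k x + (dF Q h k x + Fvec sbar (fun m => h1 h m x) k)) *
    (h2 h k x + (dF Q h k x + Fvec sbar (fun m => h1 h m x) k)) * weight x)).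
  by apply: integrableDR => //; exact: integrableZR.
by apply: eq_integrable => // x _; rewrite /= /remainder; congr EFin; ring.
Qed.

(** Exact, because the Taylor expansion of a quadratic map stops at second order. *)
Lemma residual_add Q h k x :
  residual (addH2 Q h) k x = residual Q k x + dresidual Q h k x + Fvec sbar (fun m => h1 h m x) k.
Proof.
rewrite /residual /dresidual /dF /= -![Fvec _ _ _]/(bilin (Fk k) _ _) bilinDl !bilinDr; ring.
Qed.

Lemma isH2_add Q h : isH2 b Q -> isH2 b h -> isH2 b (addH2 Q h).
Proof.
move=> HQ Hh; have := isH2_scale_add b0 1 HQ Hh; congr isH2.
by rewrite /addH2 /=; congr mkH2; do 2 (apply: funext => ?); rewrite mul1r.
Qed.

(** This identity serves twice: an upper bound on the right side gives Fréchet differentiability, a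
    lower bound gives strict convexity. *)
Lemma Jbar_expansion Q h : isH2 b Q -> isH2 b h ->
  Jbar sbar b lam (addH2 Q h) - Jbar sbar b lam Q - Jderiv Q h =
  \sum_(k < N) Rintegral mu `[0, b] (fun x => remainder Q h k x * weight x).
Proof.
move=> HQ Hh; have HQh := isH2_add HQ Hh.
rewrite !Jbar_sum// /Jderiv -!sumrB; apply: eq_bigr => k _.
have I1 := integrable_residual_sqr k HQh; have I2 := integrable_residual_sqr k HQ.
have I3 := integrable_Jderiv k HQ Hh; have I4 := integrable_remainder k HQ Hh.
apply/eqP; rewrite !subr_eq; apply/eqP.
rewrite -!RintegralD//; last exact: integrableDR.
by apply: eq_Rintegral => x _; rewrite residual_add /remainder /dresidual; ring.
Qed.

Lemma Jderiv_linear Q a u v : isH2 b Q -> isH2 b u -> isH2 b v ->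
  Jderiv Q (addH2 (scaleH2 a u) v) = a * Jderiv Q u + Jderiv Q v.
Proof.
move=> HQ Hu Hv; rewrite /Jderiv mulr_sumr -big_split; apply: eq_bigr => k _ /=.
have Iu := integrable_Jderiv k HQ Hu; have Iv := integrable_Jderiv k HQ Hv.
rewrite -RintegralZl// -RintegralD//; last exact: integrableZR.
apply: eq_Rintegral => x _; rewrite /dresidual /dF /=.
by rewrite !bilinDl !bilinDr !bilinZl !bilinZr; ring.
Qed.

End functional.

(** * Estimates of the remainder *)

Section estimates.
Context (R : realType) (N : nat) (sbar b lam : R) (b0 : 0 < b) (lam0 : 0 < lam).
Notation mu := (@lebesgue_measure R).
Implicit Types (Q P h u v : H2fun R N) (i k : 'I_N).

(** Summing over [k] as well gives one constant valid for every component of the nonlinearity. *)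
Definition Fnorm : R := \sum_(k < N) \sum_(m < N) \sum_(n < N) `|Fcoef sbar k m n|.
Notation K := Fnorm.

Lemma Fnorm_ge0 : 0 <= K.
Proof. by do 3 (apply: sumr_ge0 => ? _). Qed.

Lemma le_Fnorm k : \sum_(m < N) \sum_(n < N) `|Fk sbar k m n| <= K.
Proof.
rewrite /Fnorm /Fk [leRHS](bigD1 k)//= lerDl; apply: sumr_ge0 => ? _.
by do 2 (apply: sumr_ge0 => ? _).
Qed.

Lemma Fvec_le (v : 'I_N -> R) k (s : R) : 0 <= s -> (forall i, `|v i| <= s) ->
  `|Fvec sbar v k| <= K * s ^+ 2.
Proof. by move=> s0 vs; rewrite expr2 mulrA; exact: (bilin_le (le_Fnorm k) s0 s0 vs vs). Qed.

Lemma dF_le Q h k x (U s : R) : 0 <= U -> 0 <= s -> (forall i, `|h1 Q i x| <= U) ->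
  (forall i, `|h1 h i x| <= s) -> `|dF sbar Q h k x| <= 2 * K * U * s.
Proof.
move=> U0 s0 uU ps; rewrite (le_trans (ler_normD _ _))//.
have := bilin_le (le_Fnorm k) U0 s0 uU ps; have := bilin_le (le_Fnorm k) s0 U0 ps uU.
lra.
Qed.

(** In the quadratic term one factor [h'] is bounded by the uniform [V] and the other by [s]. The
    whole is then linear in [s], and its square is comparable with [|h'|^2]. *)
Lemma dF_Fvec_le Q h k x (U V s : R) : 0 <= U -> 0 <= V -> 0 <= s -> (forall i, `|h1 Q i x| <= U) ->
  (forall i, `|h1 h i x| <= V) -> (forall i, `|h1 h i x| <= s) ->
  `|dF sbar Q h k x + Fvec sbar (fun m => h1 h m x) k| <= K * (2 * U + V) * s.
Proof.
move=> U0 V0 s0 uU pV ps; rewrite (le_trans (ler_normD _ _))//.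
have := dF_le k U0 s0 uU ps; have : `|Fvec _ _ k| <= _ := bilin_le (le_Fnorm k) V0 s0 pV ps.
lra.
Qed.

Lemma integrable_norm_residual Q k : isH2 b Q ->
  mu.-integrable `[0, b] (EFin \o (fun x => `|residual sbar Q k x|)).
Proof.
move=> HQ; apply: integrable_norm; apply: sqint_integrable => //; first exact: itv_lty.
exact: residual_sqint.
Qed.

(** Only the L1 norm of the residual is required, since in the lower bound it multiplies
    [|h'|^2 phi^2], which is bounded uniformly in [x]. The bound does not involve [lam]. *)
Lemma Rintegral_residual_le Q k (U : R) : isH2 b Q -> 0 <= U ->
  (forall i (x : R), 0 <= x <= b -> `|h1 Q i x| <= U) ->
  Rintegral mu `[0, b] (fun x => `|residual sbar Q k x|) <=
    b + H2norm b Q ^+ 2 + b * (K * U ^+ 2).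
Proof.
move=> HQ U0 hU.
have IQ : mu.-integrable `[0, b] (EFin \o (fun x => `|h2 Q k x|)).
  by apply: integrable_norm; exact: isH2_integrable2.
have Ic : mu.-integrable `[0, b] (EFin \o (fun=> K * U ^+ 2)).
  by apply: bmeas_integrable => //; [exact: itv_lty|exact: bmeas_cst].
apply: (@le_trans _ _ (Rintegral mu `[0, b] (fun x => `|h2 Q k x| + K * U ^+ 2))).
  apply: le_Rintegral => //.
  - exact: integrable_norm_residual.
  - exact: integrableDR.
  - move=> x; rewrite /= in_itv/= => xI; rewrite (le_trans (ler_normD _ _))// lerD2l.
    by apply: Fvec_le => // i; exact: hU.
rewrite RintegralD// Rintegral_itv_cst ?(ltW b0)// [_ * b]mulrC lerD2r.
apply: le_trans (Rintegral_abs_le_sqr (ltW b0) (isH2_sqint k HQ)) _.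
by rewrite lerD2l Rintegral_h2_le.
Qed.

Lemma integrable_h2_weight h k : isH2 b h ->
  mu.-integrable `[0, b] (EFin \o (fun x => h2 h k x ^+ 2 * weight lam x)).
Proof.
move=> Hh; have := integrable_mul_weight lam (isH2_sqint k Hh) (isH2_sqint k Hh).
by apply: eq_integrable => // x _; rewrite /= -expr2.
Qed.

Lemma Rintegral_affine (a c e : R) (f g : R -> R) :
  mu.-integrable `[0, b] (EFin \o f) -> mu.-integrable `[0, b] (EFin \o g) ->
  mu.-integrable `[0, b] (EFin \o (fun x => a * f x + c * g x + e)) /\
  Rintegral mu `[0, b] (fun x => a * f x + c * g x + e) =
    a * Rintegral mu `[0, b] f + c * Rintegral mu `[0, b] g + b * e.
Proof.
move=> If Ig.
have Iaf : mu.-integrable `[0, b] (EFin \o (fun x => a * f x)) by exact: integrableZR.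
have Icg : mu.-integrable `[0, b] (EFin \o (fun x => c * g x)) by exact: integrableZR.
have Ifg : mu.-integrable `[0, b] (EFin \o (fun x => a * f x + c * g x)) by exact: integrableDR.
have Ie : mu.-integrable `[0, b] (EFin \o (fun=> e)).
  by apply: bmeas_integrable => //; [exact: itv_lty|exact: bmeas_cst].
split; first exact: integrableDR.
rewrite RintegralD// RintegralD// RintegralZl// RintegralZl//.
by rewrite Rintegral_itv_cst ?(ltW b0)// [e * b]mulrC.
Qed.

(** Integrated form of [sqr_remainder_ge]. All negative terms carry the factor [sigma], a sup bound
    on [|h'|^2 phi^2], which the Carleman-type estimate later makes small. *)
Lemma Rintegral_remainder_ge Q h k (U V sigma : R) : isH2 b Q -> isH2 b h -> 0 <= U -> 0 <= V ->
  0 <= sigma ->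
  (forall i (x : R), 0 <= x <= b -> `|h1 Q i x| <= U) ->
  (forall i (x : R), 0 <= x <= b -> `|h1 h i x| <= V) ->
  (forall i (x : R), 0 <= x <= b -> h1 h i x ^+ 2 * weight lam x <= sigma) ->
  Rintegral mu `[0, b] (fun x => h2 h k x ^+ 2 * weight lam x) / 2
    - sigma * (2 * K * Rintegral mu `[0, b] (fun x => `|residual sbar Q k x|)
               + b * (K * (2 * U + V)) ^+ 2)
  <= Rintegral mu `[0, b] (fun x => remainder sbar Q h k x * weight lam x).
Proof.
move=> HQ Hh U0 V0 sigma0 hU hV hs; set T := K * (2 * U + V).
have Ih := integrable_h2_weight k Hh; have Ir := integrable_norm_residual k HQ.
have [Iaff aff] := Rintegral_affine 2^-1 (- (2 * K * sigma)) (- (T ^+ 2 * sigma)) Ih Ir.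
have -> : forall A B, A / 2 - sigma * (2 * K * B + b * T ^+ 2) =
    2^-1 * A + - (2 * K * sigma) * B + b * - (T ^+ 2 * sigma) by move=> A B; ring.
rewrite -aff; apply: le_Rintegral => //.
- exact: integrable_remainder.
- move=> x; rewrite /= in_itv/= => xI; have w0 := weight_gt0 lam x.
  (* The pointwise bound on [|h'|] is chosen with [s ^+ 2 * weight lam x = sigma], so that each
     [s ^+ 2] turns into the constant [sigma] after multiplication by the weight. *)
  pose s := Num.sqrt (sigma / weight lam x).
  have s2 : s ^+ 2 * weight lam x = sigma.
    by rewrite sqr_sqrtr ?divfK ?gt_eqF// divr_ge0// ltW.
  have s0 : 0 <= s by exact: sqrtr_ge0.
  have ps i : `|h1 h i x| <= s by rewrite -sqrtr_sqr ler_wsqrtr// ler_pdivlMr// hs.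
  have T0 : 0 <= T by rewrite !mulr_ge0 ?Fnorm_ge0// addr_ge0// mulr_ge0.
  have FK := Fvec_le k s0 ps.
  have BT := dF_Fvec_le k U0 V0 s0 (fun i => hU i x xI) (fun i => hV i x xI) ps.
  have := sqr_remainder_ge (residual sbar Q k x) (h2 h k x) (mulr_ge0 T0 s0) FK BT.
  move=> /(ler_wpM2r (ltW w0)); apply: le_trans; rewrite -s2 le_eqVlt; apply/orP; left.
  by apply/eqP; ring.
Qed.

(** Integrates [sqr_remainder_le], the weight being at most 1. When [s] is proportional to the norm
    of [h], every term is of second order in that norm. *)
Lemma Rintegral_remainder_le Q h k (U V s : R) : isH2 b Q -> isH2 b h ->
  0 <= U -> 0 <= V -> 0 <= s ->
  (forall i (x : R), 0 <= x <= b -> `|h1 Q i x| <= U) ->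
  (forall i (x : R), 0 <= x <= b -> `|h1 h i x| <= V) ->
  (forall i (x : R), 0 <= x <= b -> `|h1 h i x| <= s) ->
  `|Rintegral mu `[0, b] (fun x => remainder sbar Q h k x * weight lam x)| <=
  2 * K * s ^+ 2 * Rintegral mu `[0, b] (fun x => `|residual sbar Q k x|)
  + 2 * Rintegral mu `[0, b] (fun x => h2 h k x ^+ 2)
  + 2 * b * (K * (2 * U + V)) ^+ 2 * s ^+ 2.
Proof.
move=> HQ Hh U0 V0 s0 hU hV hs; set T := K * (2 * U + V).
have [_ Ih] := isH2_sqint k Hh; have Ir := integrable_norm_residual k HQ.
have Irem := integrable_remainder sbar lam b0 k HQ Hh.
have [Iaff aff] := Rintegral_affine (2 * K * s ^+ 2) 2 (2 * T ^+ 2 * s ^+ 2) Ir Ih.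
have -> : 2 * b * T ^+ 2 * s ^+ 2 = b * (2 * T ^+ 2 * s ^+ 2) by ring.
rewrite -aff; apply: le_trans (le_normr_Rintegral _ Irem) _ => //.
apply: le_Rintegral => //.
- exact: integrable_norm.
- move=> x; rewrite /= in_itv/= => xI.
  have T0 : 0 <= T by rewrite !mulr_ge0 ?Fnorm_ge0// addr_ge0// mulr_ge0.
  have ps i : `|h1 h i x| <= s by exact: hs.
  have FK := Fvec_le k s0 ps.
  have BT := dF_Fvec_le k U0 V0 s0 (fun i => hU i x xI) (fun i => hV i x xI) ps.
  have := sqr_remainder_le (residual sbar Q k x) (h2 h k x) (mulr_ge0 T0 s0) FK BT.
  apply: le_trans; rewrite normrM (ger0_norm (weight_ge0 lam x)).
  by rewrite ler_piMr// weight_le1//; case/andP: xI.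
Qed.

Lemma norm_h1_le h i x : H0adm b h -> 0 <= x <= b -> `|h1 h i x| <= Num.sqrt b * H2norm b h.
Proof.
move=> [Hh hz] xI; have [_ [h10 _]] := hz i.
have n0 := H2norm_ge0 b h.
rewrite -[`|_|]sqrtr_sqr -[H2norm b h]ger0_norm// -sqrtr_sqr -sqrtrM ?(ltW b0)// ler_wsqrtr//.
apply: le_trans (isH2_sqr_h1_le Hh h10 xI) _.
by rewrite ler_wpM2l ?(ltW b0)// Rintegral_h2_le.
Qed.

(** Cauchy-Schwarz between the fixed weighted residual and [dresidual], whose L2 norm is at most
    [sqrt C] times the [H2] norm of [h]. *)
Lemma Jderiv_bounded Q (U : R) : isH2 b Q -> 0 <= U ->
  (forall i (x : R), 0 <= x <= b -> `|h1 Q i x| <= U) ->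
  exists M : R, forall h, H0adm b h -> `|Jderiv sbar b lam Q h| <= M * H2norm b h.
Proof.
(* The 2s come from [(x + y)^2 <= 2 x^2 + 2 y^2]. The last term is the sup bound on [dF] with
   [|h'| <= sqrt b * H2norm b h], squared and integrated over an interval of length [b]. *)
move=> HQ U0 hU; pose C := 2 + 2 * b * ((2 * K * U) ^+ 2 * b).
pose r k x := 2 * residual sbar Q k x * weight lam x.
pose A k := Rintegral mu `[0, b] (fun x => r k x ^+ 2).
exists (\sum_(k < N) Num.sqrt (A k * C)) => h Hadm; have [Hh _] := Hadm.
have n0 := H2norm_ge0 b h.
have C0 : 0 <= C.
  have b_ge0 := ltW b0; apply: addr_ge0 => //.
  by apply: mulr_ge0; apply: mulr_ge0 => //; exact: sqr_ge0.
rewrite mulr_suml (le_trans (ler_norm_sum _ _ _))//; apply: ler_sum => k _.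
have sr : sqint mu `[0, b] (r k).
  apply: sqint_bmeas => //; last exact: weight_bmeas.
  by apply: sqintZ => //; exact: residual_sqint.
have sd := dresidual_sqint sbar b0 k HQ Hh.
have sF := dF_sqint sbar b0 k HQ Hh.
have s2 := isH2_sqint k Hh.
have A0 : 0 <= A k by apply: Rintegral_ge0 => x _; exact: sqr_ge0.
have dle : Rintegral mu `[0, b] (fun x => dresidual sbar Q h k x ^+ 2) <= C * H2norm b h ^+ 2.
  have [_ Id] := sd; have [_ IF] := sF; have [_ I2] := s2.
  apply: (@le_trans _ _ (Rintegral mu `[0, b]
      (fun x => 2 * h2 h k x ^+ 2 + 2 * dF sbar Q h k x ^+ 2))).
    apply: le_Rintegral => //.
    - by apply: integrableDR => //; exact: integrableZR.
    - by move=> x _; rewrite /dresidual; have := sqr_ge0 (h2 h k x - dF sbar Q h k x); nra.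
  rewrite RintegralD//; [|exact: integrableZR|exact: integrableZR].
  rewrite !RintegralZl//.
  have L2 := Rintegral_h2_le b0 k Hh.
  have LF : Rintegral mu `[0, b] (fun x => dF sbar Q h k x ^+ 2) <=
      b * ((2 * K * U) ^+ 2 * b * H2norm b h ^+ 2).
    apply: le_Rintegral_sup => // x xI.
    have := dF_le k U0 _ (fun i => hU i x xI) (fun i => norm_h1_le i Hadm xI).
    move=> /(_ (mulr_ge0 (sqrtr_ge0 _) n0)) => dFb.
    rewrite -[dF _ _ _ _ _ ^+ 2]real_normK ?num_real//.
    have -> : (2 * K * U) ^+ 2 * b * H2norm b h ^+ 2 =
        (2 * K * U * (Num.sqrt b * H2norm b h)) ^+ 2.
      by rewrite !exprMn [Num.sqrt b ^+ 2]sqr_sqrtr ?(ltW b0)//; ring.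
    by rewrite lerXn2r ?nnegrE// (le_trans _ dFb).
  by rewrite /C; lra.
have -> : Rintegral mu `[0, b]
    (fun x => 2 * residual sbar Q k x * dresidual sbar Q h k x * weight lam x) =
  Rintegral mu `[0, b] (fun x => r k x * dresidual sbar Q h k x).
  by apply: eq_Rintegral => x _; rewrite /r; ring.
have := @Cauchy_Schwarz_Rintegral _ _ _ mu _ _ _ (measurable_itv _) sr sd.
move=> /le_trans/(_ (ler_wpM2l A0 dle)) CS.
rewrite -[H2norm b h]ger0_norm// -[`|H2norm b h|]sqrtr_sqr -sqrtrM ?mulr_ge0//.
by rewrite -sqrtr_sqr ler_wsqrtr// -mulrA.
Qed.

Lemma Jderiv_frechet Q (U : R) : isH2 b Q -> 0 <= U ->
  (forall i (x : R), 0 <= x <= b -> `|h1 Q i x| <= U) ->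
  is_frechet_deriv b (Jbar sbar b lam) Q (Jderiv sbar b lam Q).
Proof.
move=> HQ U0 hU; split; first by move=> a u v [Hu _] [Hv _]; exact: Jderiv_linear.
split; first exact: Jderiv_bounded hU.
move=> eps eps0; set T := K * (2 * U + Num.sqrt b).
(* The coefficient of [H2norm b h ^+ 2] after inserting [s ^+ 2 = b * H2norm b h ^+ 2] and
   [V = sqrt b] in [Rintegral_remainder_le]. *)
pose C := \sum_(k < N) (2 * K * b * Rintegral mu `[0, b] (fun x => `|residual sbar Q k x|)
  + 2 + 2 * b * T ^+ 2 * b).
have C0 : 0 <= C.
  have b_ge0 := ltW b0; apply: sumr_ge0 => k _; apply: addr_ge0; first apply: addr_ge0 => //.
    by rewrite !mulr_ge0 ?Fnorm_ge0//; exact: Rintegral_ge0.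
  by apply: mulr_ge0 => //; apply: mulr_ge0; [exact: mulr_ge0|exact: sqr_ge0].
(* Norm below 1 makes [sqrt b] a uniform bound on [|h'|]; the second bound turns
   [C * H2norm b h ^+ 2] into [eps * H2norm b h], with [C + 1] keeping the denominator positive. *)
exists (Num.min 1 (eps / (C + 1))); split.
  by rewrite lt_min ltr01 divr_gt0// ltr_wpDl.
move=> h Hadm; rewrite lt_min => /andP[n1 nd]; have [Hh _] := Hadm.
have n0 := H2norm_ge0 b h.
rewrite Jbar_expansion//; apply: (@le_trans _ _ (C * H2norm b h ^+ 2)); last first.
  rewrite expr2 mulrA ler_wpM2r//; move: nd; rewrite ltr_pdivlMr ?ltr_wpDl// => nd.
  by rewrite mulrC; nra.
rewrite mulr_suml (le_trans (ler_norm_sum _ _ _))//; apply: ler_sum => k _.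
pose s := Num.sqrt b * H2norm b h.
have s2 : s ^+ 2 = b * H2norm b h ^+ 2 by rewrite exprMn [Num.sqrt b ^+ 2]sqr_sqrtr// ltW.
have hs i x : 0 <= x <= b -> `|h1 h i x| <= s by exact: norm_h1_le.
have hV i x : 0 <= x <= b -> `|h1 h i x| <= Num.sqrt b.
  by move=> xI; rewrite (le_trans (hs i x xI))// ler_piMr ?sqrtr_ge0// ltW.
have := Rintegral_remainder_le k HQ Hh U0 (sqrtr_ge0 b) (mulr_ge0 (sqrtr_ge0 b) n0) hU hV hs.
move=> /le_trans; apply; rewrite -/s s2 -/T.
by have := Rintegral_h2_le b0 k Hh; clear; clearbody T; lra.
Qed.

End estimates.

(** * Strict convexity *)

Section convexity.
Context (R : realType) (N : nat) (sbar b Rr : R) (Phi0 Psi0 Psib : 'I_N -> R) (b0 : 0 < b).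
Notation mu := (@lebesgue_measure R).
Notation G1 := (G1 b Rr Phi0 Psi0 Psib).
Notation K := (Fnorm N sbar).
Implicit Types (Q : H2fun R N) (lam : R).

(** The bound of [isH2_h1_le] over [G1], with the initial slopes summed so that it fits all
    components. *)
Definition supbound : R := \sum_(i < N) `|Psi0 i| + (b + Rr ^+ 2).

Lemma supbound_ge0 : 0 <= supbound.
Proof. by rewrite addr_ge0 ?sumr_ge0// addr_ge0 ?sqr_ge0// ltW. Qed.

Lemma sqr_H2norm_G1 Q : G1 Q -> H2norm b Q ^+ 2 <= Rr ^+ 2.
Proof.
move=> [_ [QR _]]; have Q0 := H2norm_ge0 b Q; have := ltW QR.
by move=> QR'; rewrite lerXn2r ?nnegrE// (le_trans Q0).
Qed.

Lemma G1_h1_le Q i (x : R) : G1 Q -> 0 <= x <= b -> `|h1 Q i x| <= supbound.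
Proof.
move=> GQ xI; have nQ := sqr_H2norm_G1 GQ; have [HQ [_ /(_ i)[_ [hi _]]]] := GQ.
rewrite (le_trans (isH2_h1_le b0 i HQ xI))// hi lerD//.
  by rewrite (bigD1 i)//= lerDl sumr_ge0.
by rewrite lerD2l (le_trans _ nQ)// Rintegral_h2_le.
Qed.

Lemma subH2_adm Q1 Q2 : G1 Q1 -> G1 Q2 -> H0adm b (subH2 Q2 Q1).
Proof.
move=> [H1 [_ bc1]] [H2 [_ bc2]]; split.
  have := isH2_scale_add b0 (-1) H1 H2; congr isH2.
  by rewrite /addH2 /subH2 /=; congr mkH2; do 2 (apply: funext => ?); rewrite mulN1r addrC.
move=> i; have [p0 [p1 pb]] := bc1 i; have [q0 [q1 qb]] := bc2 i.
by rewrite /= p0 p1 pb q0 q1 qb !subrr.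
Qed.

Lemma addH2_subH2 (Q1 Q2 : H2fun R N) : addH2 Q1 (subH2 Q2 Q1) = Q2.
Proof.
by case: Q2 => a c e; rewrite /addH2 /subH2 /=; congr mkH2; do 2 (apply: funext => ?);
  rewrite addrC subrK.
Qed.

(** The factor of [sigma] in [Rintegral_remainder_ge] for [U = supbound] and [V = 2 * supbound],
    with the residual replaced by its uniform L1 bound. It is independent of [lam]. *)
Definition carleman_const : R :=
  2 * K * (b + Rr ^+ 2 + b * (K * supbound ^+ 2))
  + b * (K * (2 * supbound + 2 * supbound)) ^+ 2.

Lemma carleman_const_ge0 : 0 <= carleman_const.
Proof.
have b_ge0 := ltW b0; have K0 := Fnorm_ge0 N sbar.
apply: addr_ge0; last by rewrite mulr_ge0// sqr_ge0.
by rewrite mulr_ge0 ?mulr_ge0// !addr_ge0 ?sqr_ge0// mulr_ge0// mulr_ge0// sqr_ge0.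
Qed.

(** Summing the component bounds gives [E / 2 - N * E * W / (2 * lam)], [W] being [carleman_const];
    the loss is at most [E / 4] exactly when [2 * N * W <= lam], provided [E > 0]. *)
Lemma sum_remainder_ge lam Q1 Q2 : 0 < lam -> 2 * N%:R * carleman_const <= lam ->
  G1 Q1 -> G1 Q2 ->
  (\sum_(k < N) Rintegral mu `[0, b] (fun x => h2 (subH2 Q2 Q1) k x ^+ 2 * weight lam x)) / 4 <=
  \sum_(k < N) Rintegral mu `[0, b]
    (fun x => remainder sbar Q1 (subH2 Q2 Q1) k x * weight lam x).
Proof.
move=> lam0 lamW G1Q G2Q; have [H1 _] := G1Q; have [Hh hz] := subH2_adm G1Q G2Q.
set h := subH2 Q2 Q1 in Hh hz *; set E := \sum_(k < N) _.
pose Ek k := Rintegral mu `[0, b] (fun x => h2 h k x ^+ 2 * weight lam x).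
have Ek0 k : 0 <= Ek k.
  by apply: Rintegral_ge0 => x _; rewrite mulr_ge0 ?sqr_ge0 ?weight_ge0.
have E0 : 0 <= E by apply: sumr_ge0 => k _; exact: Ek0.
(* Each component energy is at most the total [E], so one [sigma = E / (2 * lam)] serves every
   component. *)
have hs i (x : R) : 0 <= x <= b -> h1 h i x ^+ 2 * weight lam x <= E / (2 * lam).
  move=> xI; have [_ [h10 _]] := hz i.
  apply: le_trans (isH2_h1_weighted Hh h10 lam0 xI) _.
  rewrite ler_wpM2r// ?invr_ge0 ?mulr_ge0 ?(ltW lam0)//.
  under eq_Rintegral do rewrite exprMn.
  by rewrite -/(Ek i) /E (bigD1 i)//= lerDl; apply: sumr_ge0 => k _; exact: Ek0.
have U0 := supbound_ge0; have K0 := Fnorm_ge0 N sbar.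
have hU i (x : R) : 0 <= x <= b -> `|h1 Q1 i x| <= supbound by exact: G1_h1_le.
have hV i (x : R) : 0 <= x <= b -> `|h1 h i x| <= 2 * supbound.
  move=> xI; rewrite /h /= (le_trans (ler_normB _ _))//.
  by rewrite mulr_natl mulr2n lerD// G1_h1_le.
have V0 : 0 <= 2 * supbound by rewrite mulr_ge0.
have s0 : 0 <= E / (2 * lam) by rewrite divr_ge0// mulr_ge0// ltW.
have rem k : Ek k / 2 - E / (2 * lam) * carleman_const <=
    Rintegral mu `[0, b] (fun x => remainder sbar Q1 h k x * weight lam x).
  have := Rintegral_remainder_ge sbar b0 k H1 Hh U0 V0 s0 hU hV hs.
  apply: le_trans; rewrite lerD2l lerN2 ler_wpM2l// lerD2r ler_wpM2l ?mulr_ge0//.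
  apply: le_trans (Rintegral_residual_le sbar b0 k H1 U0 hU) _.
  by rewrite lerD2r lerD2l sqr_H2norm_G1.
apply: le_trans (ler_sum _ (fun k _ => rem k)).
rewrite sumrB -mulr_suml sumr_const card_ord -/E -mulr_natl.
have : E * (2 * N%:R * carleman_const) <= E * lam by rewrite ler_wpM2l.
set W := carleman_const => EW.
have : N%:R * (E / (2 * lam) * W) <= E / 4.
  have -> : N%:R * (E / (2 * lam) * W) = E * (2 * N%:R * W) / (4 * lam).
    by field; rewrite gt_eqF.
  by rewrite ler_pdivrMr ?mulr_gt0//; lra.
lra.
Qed.

(** The weight is smallest at [x = b], and [sqr_H2norm_le] recovers the full norm from [h2]. *)
Lemma sum_h2_weight_ge lam h : 0 < lam -> H0adm b h ->
  expR (- (2 * lam * b)) * H2norm b h ^+ 2 / (1 + b ^+ 2 + b ^+ 4) <=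
  \sum_(k < N) Rintegral mu `[0, b] (fun x => h2 h k x ^+ 2 * weight lam x).
Proof.
move=> lam0 Hadm; have [Hh _] := Hadm.
have c0 : 0 < 1 + b ^+ 2 + b ^+ 4 by rewrite !ltr_wpDr ?exprn_ge0 ?(ltW b0).
rewrite ler_pdivrMr// (le_trans (ler_wpM2l (expR_ge0 _) (sqr_H2norm_le b0 Hadm)))//.
rewrite mulrCA [leRHS]mulrC ler_wpM2l ?(ltW c0)// mulr_sumr; apply: ler_sum => k _.
have [_ Ih] := isH2_sqint k Hh.
rewrite -RintegralZl//; apply: le_Rintegral => //.
- exact: integrableZR.
- exact: integrable_h2_weight.
- move=> x; rewrite /= in_itv/= => /andP[_ xb]; rewrite mulrC ler_wpM2l ?sqr_ge0//.
  exact: weight_ge.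
Qed.

End convexity.

Unset Implicit Arguments.

Theorem theorem4 (R : realType) (N : nat) (b Rr sbar : R)
    (Phi0 Psi0 Psib : 'I_N -> R) :
  0 < b -> (0 < N)%N -> 0 < Rr -> 0 < sbar ->
  exists lam2 : R, 1 < lam2 /\
  exists C3 : R, 0 < C3 /\
  forall lam : R, lam2 <= lam ->
  forall Q1 : H2fun R N, G1 b Rr Phi0 Psi0 Psib Q1 ->
  exists L : H2fun R N -> R,
    is_frechet_deriv b (Jbar sbar b lam) Q1 L /\
    forall Q2 : H2fun R N, G1 b Rr Phi0 Psi0 Psib Q2 ->
      Jbar sbar b lam Q2 - Jbar sbar b lam Q1 - L (subH2 Q2 Q1)
        >= C3 * expR (- (2 * lam * b)) * H2norm b (subH2 Q2 Q1) ^+ 2.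
Proof.
move=> b0 _ _ _; pose W := carleman_const sbar b Rr Psi0.
have NW0 : 0 <= 2 * N%:R * W by rewrite mulr_ge0 ?mulr_ge0// carleman_const_ge0.
have c0 : 0 < 1 + b ^+ 2 + b ^+ 4 by rewrite !ltr_wpDr ?exprn_ge0 ?(ltW b0).
(* The 2 puts the threshold above 1; the rest is what [sum_remainder_ge] demands. Only the data of
   [G1] and the coefficients of the nonlinearity enter. *)
exists (2 + 2 * N%:R * W); split; first by rewrite ltr_wpDr// ltr1n.
(* The 4 comes from the surviving quarter of the energy, the other factor from [sqr_H2norm_le]. *)
exists (4 * (1 + b ^+ 2 + b ^+ 4))^-1; split; first by rewrite invr_gt0 mulr_gt0.
move=> lam lam2 Q1 GQ1; have [HQ1 _] := GQ1.
have lam0 : 0 < lam by apply: lt_le_trans lam2; rewrite ltr_wpDr.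
have lamW : 2 * N%:R * W <= lam by apply: le_trans lam2; rewrite lerDr.
exists (Jderiv sbar b lam Q1); split.
  exact: (Jderiv_frechet sbar b0 lam0 HQ1 (supbound_ge0 Rr Psi0 b0)
    (fun i x => G1_h1_le b0 i GQ1)).
move=> Q2 GQ2; have Hadm := subH2_adm b0 GQ1 GQ2; have [Hh _] := Hadm.
have := Jbar_expansion sbar lam b0 HQ1 Hh; rewrite addH2_subH2 => ->.
apply: le_trans (sum_remainder_ge b0 lam0 lamW GQ1 GQ2).
apply: le_trans (ler_wpM2r _ (sum_h2_weight_ge b0 lam0 Hadm)) => //.
rewrite le_eqVlt; apply/orP; left; apply/eqP; field; exact: lt0r_neq0.
Qed.
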